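(* Let $X$ and $Y$ be WLD Banach spaces. If either $(B_{X^*},w^* )$ or $(B_{Y^*},w^* )$ has property (M), then the injective tensor product $X\widehat{\otimes}_\varepsilon Y$ is WLD.
   Context: All Banach spaces are real; an operator is a continuous linear map. $(B_{X^*},w^* )$ is the closed unit ball of $X^*$ with the weak$^*$ topology. For a non-empty set $\Gamma$, $\ell_\infty^c(\Gamma)$ is the subspace of $\ell_\infty(\Gamma)$ consisting of all bounded functions $f:\Gamma\to\mathbb{R}$ with countable support, and $\tau_p(\Gamma)$ is the topology of pointwise convergence on $\Gamma$. A Banach space $X$ is weakly Lindelöf determined (WLD) if there exist a non-empty set $\Gamma$ and an injective operator $\Phi:X^*\to\ell_\infty^c(\Gamma)$ which is $w^*$-to-$\tau_p(\Gamma)$ continuous. Equivalently, $(B_{X^*},w^* )$ is a Corson compact space, i.e. it embeds homeomorphically into $[-1,1]^\Gamma\cap\ell_\infty^c(\Gamma)$ with $\tau_p(\Gamma)$ for some $\Gamma$. A Corson compact space $K$ has property (M) if every regular Borel probability measure on $K$ has separable support. *)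

(* Defs.v *)
From HB Require Import structures.
From mathcomp Require Import all_boot all_order all_algebra.
From mathcomp Require Import all_classical all_reals all_analysis.

Set Implicit Arguments.
Unset Strict Implicit.
Unset Printing Implicit Defensive.

Import Order.TTheory GRing.Theory Num.Theory.
Import numFieldNormedType.Exports.

Local Open Scope classical_set_scope.
Local Open Scope ring_scope.

Section SupNorm.
Context {R : realType} {T : Type}.
Implicit Types (A : set T) (f g : T -> R).

Definition sup_norm A f : R := sup [set `|f x| | x in A].

Definition bounded_on A f := [bounded f x | x in A].

Lemma bounded_onP A f :
  bounded_on A f <-> exists M, forall x, A x -> `|f x| <= M.
Proof.
split=> [/pinfty_ex_gt0[M _ fM]|[M fM]]; first by exists M.
rewrite /bounded_on /bounded_near; near=> N => x Ax.
apply: (le_trans (fM x Ax)); near: N.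
exact: nbhs_pinfty_ge (num_real M).
Unshelve. all: by end_near. Qed.

Lemma sup_norm_ub A f x : bounded_on A f -> A x -> `|f x| <= sup_norm A f.
Proof.
move=> /bounded_onP[M fM] Ax; apply: ub_le_sup; last by exists x.
by exists M => _ [y Ay <-]; exact: fM.
Qed.

Lemma sup_norm_le A f (M : R) : 0 <= M -> (forall x, A x -> `|f x| <= M) ->
  sup_norm A f <= M.
Proof.
move=> M0 fM; rewrite /sup_norm; have [->|/set0P[x Ax]] := eqVneq A set0.
  by rewrite image_set0 sup0.
apply: ge_sup; first by exists `|f x|; exists x.
by move=> _ [y Ay <-]; exact: fM.
Qed.

Lemma sup_norm_ge0 A f : 0 <= sup_norm A f.
Proof.
rewrite /sup_norm; have [[[y yE] ubE]|/sup_out->//] := pselect (has_sup [set `|f x| | x in A]).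
have y0 : 0 <= y by case: yE => x _ <-.
exact: le_trans y0 (ub_le_sup ubE yE).
Qed.

Lemma bounded_on0 A : bounded_on A (0 : T -> R).
Proof. by apply/bounded_onP; exists 0 => x _; rewrite normr0. Qed.

Lemma bounded_onD A f g :
  bounded_on A f -> bounded_on A g -> bounded_on A (f + g).
Proof.
move=> /bounded_onP[M fM] /bounded_onP[N gN]; apply/bounded_onP; exists (M + N) => x Ax.
by rewrite (le_trans (ler_normD _ _))// lerD ?fM ?gN.
Qed.

Lemma bounded_onZ A (a : R) f : bounded_on A f -> bounded_on A (a *: f).
Proof.
move=> /bounded_onP[M fM]; apply/bounded_onP; exists (`|a| * M) => x Ax.
by rewrite normrM ler_wpM2l ?fM.
Qed.

Lemma sup_normD A f g : bounded_on A f -> bounded_on A g ->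
  sup_norm A (f + g) <= sup_norm A f + sup_norm A g.
Proof.
move=> bf bg; apply: sup_norm_le => [|x Ax]; first by rewrite addr_ge0 ?sup_norm_ge0.
by rewrite (le_trans (ler_normD _ _))// lerD ?sup_norm_ub.
Qed.

Lemma sup_normZ A (a : R) f : bounded_on A f ->
  sup_norm A (a *: f) = `|a| * sup_norm A f.
Proof.
move=> bf; apply/eqP; rewrite eq_le; apply/andP; split.
  apply: sup_norm_le => [|x Ax]; first by rewrite mulr_ge0 ?sup_norm_ge0.
  by rewrite normrM ler_wpM2l ?sup_norm_ub.
have [->|a0] := eqVneq a 0; first by rewrite normr0 mul0r sup_norm_ge0.
rewrite -ler_pdivlMl ?normr_gt0//; apply: sup_norm_le => [|x Ax].
  by rewrite mulr_ge0 ?sup_norm_ge0 ?invr_ge0.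
rewrite ler_pdivlMl ?normr_gt0// -normrM.
exact: (sup_norm_ub (bounded_onZ a bf) Ax).
Qed.

End SupNorm.

Definition linfty_pred (R : realType) (G : Type) : {pred G -> R} :=
  mem [set f : G -> R | bounded_on setT f].

Arguments linfty_pred R G _ : clear implicits.

Record linfty (R : realType) (G : Type) := Linfty {
  linfty_val :> G -> R ;
  _ : linfty_val \in linfty_pred R G }.

Section LInfty.
Context {R : realType} {G : Type}.
Notation L := (linfty R G).

HB.instance Definition _ := [isSub for @linfty_val R G].
HB.instance Definition _ := [Choice of L by <:].

Lemma linfty_submod_closed : submod_closed (linfty_pred R G).
Proof.
split; first by apply/mem_set; exact: bounded_on0.
move=> a f g /set_mem bf /set_mem bg; apply/mem_set.
by apply: bounded_onD => //; exact: bounded_onZ.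
Qed.

HB.instance Definition _ := GRing.isSubmodClosed.Build R (G -> R)
  (linfty_pred R G) linfty_submod_closed.
HB.instance Definition _ := [SubChoice_isSubLmodule of L by <:].

Lemma linftyP (f : L) : bounded_on setT f.
Proof. by case: f => f /= /set_mem. Qed.

Definition linfty_norm (f : L) : R := sup_norm setT f.

Lemma linfty_normD (f g : L) :
  linfty_norm (f + g) <= linfty_norm f + linfty_norm g.
Proof. by apply: sup_normD; exact: linftyP. Qed.

Lemma linfty_normZ (a : R) (f : L) : linfty_norm (a *: f) = `|a| * linfty_norm f.
Proof. by apply: sup_normZ; exact: linftyP. Qed.

Lemma linfty_norm_eq0 (f : L) : linfty_norm f = 0 -> f = 0.
Proof.
move=> f0; apply/val_inj/funext => x /=; apply/eqP.
by rewrite -normr_le0 -f0 sup_norm_ub//; exact: linftyP.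
Qed.

HB.instance Definition _ := Lmodule_isNormed.Build R L
  linfty_normD linfty_normZ linfty_norm_eq0.

Lemma linfty_normE (f : L) : `|f| = sup_norm setT f.
Proof. by []. Qed.

Lemma linfty_ub (f : L) t : `|f t| <= `|f|.
Proof. exact: (sup_norm_ub (linftyP f)). Qed.

Lemma linfty_distE (f g : L) t : (f - g) t = f t - g t.
Proof. by []. Qed.

Lemma linfty_complete (F : set_system L) :
  ProperFilter F -> cauchy F -> cvg F.
Proof.
move=> FF Fc.
have Fball (e : R) : 0 < e -> exists f : L, F (ball f e).
  by move=> e0; exact: (@cauchyP _ _ F FF).1 Fc e e0.
have Ft t : cvg ((fun f : L => (f t : R)) @ F).
  apply: cauchy_cvg; apply: (@cauchyP _ _ _ _).2 => e e0; have [f Ff] := Fball _ e0.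
  exists (f t); apply: (@filterS _ F _ (ball f e)) => [h|//].
  by rewrite -!ball_normE /=; apply: le_lt_trans; rewrite -linfty_distE linfty_ub.
pose g t := lim ((fun f : L => (f t : R)) @ F).
have distg (e : R) (f : L) : F (ball f e) -> forall t, `|f t - g t| <= e.
  move=> Ff t; apply/ler_addgt0Pr => d d0.
  have Fg : F [set h : L | `|g t - h t| < d] by have /cvgrPdist_lt/(_ _ d0) := Ft t.
  have [h [/= fh gh]] := filter_ex (filterI Ff Fg).
  rewrite (le_trans (ler_distD (h t) _ _))// lerD//; last by rewrite distrC ltW.
  move: fh; rewrite -ball_normE /= => /ltW; apply: le_trans.
  by rewrite -linfty_distE linfty_ub.
have bg : g \in linfty_pred R G.
  apply/mem_set/bounded_onP; have [f Ff] := Fball _ ltr01.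
  exists (`|f| + 1) => t _.
  rewrite -[g t](subrK (f t)) addrC (le_trans (ler_normD _ _))// lerD//.
    exact: linfty_ub.
  by rewrite distrC distg.
apply/cvg_ex; exists (Linfty bg); apply/cvgrPdist_le => e e0.
have e20 : 0 < e / 2 by rewrite divr_gt0.
have [f Ff] := Fball _ e20.
apply: filterS (Ff) => h fh; apply: sup_norm_le => [|t _]; first exact: ltW.
rewrite /= (le_trans (ler_distD (f t) _ _))// [e]splitr lerD//.
  by rewrite distrC distg.
move: fh; rewrite -ball_normE /= => /ltW; apply: le_trans.
by rewrite -linfty_distE linfty_ub.
Qed.

HB.instance Definition _ := Uniform_isComplete.Build L linfty_complete.

End LInfty.

Definition dual_pred (R : realType) (X : normedModType R) : {pred X -> R} :=
  mem [set f : X -> R | linear f /\ continuous f].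
Arguments dual_pred R X _ : clear implicits.

Record dual (R : realType) (X : normedModType R) := Dual {
  dual_val :> X -> R ;
  _ : dual_val \in dual_pred R X }.

Section Dual.
Context {R : realType} {X : normedModType R}.
Notation D := (dual X).

HB.instance Definition _ := [isSub for @dual_val R X].
HB.instance Definition _ := [Choice of D by <:].

Lemma dual_submod_closed : submod_closed (dual_pred R X).
Proof.
split.
  apply/mem_set; split; last exact: cst_continuous.
  by move=> a x y; rewrite [LHS]/0 /= scaler0 addr0.
move=> a f g /set_mem[lf cf] /set_mem[lg cg]; apply/mem_set; split.
  have E z : (a *: f + g) z = a * f z + g z by [].
  move=> b x y; rewrite !E lf lg mulrDr scalerDr addrACA; congr (_ + _ + _).
  by exact: mulrCA.
move=> x; apply: cvgD; last exact: cg.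
by apply: cvgM; [exact: cvg_cst|exact: cf].
Qed.

HB.instance Definition _ := GRing.isSubmodClosed.Build R (X -> R)
  (dual_pred R X) dual_submod_closed.
HB.instance Definition _ := [SubChoice_isSubLmodule of D by <:].

Lemma dual_linear (f : D) : linear (f : X -> R).
Proof. by case: f => f /= /set_mem[]. Qed.

Lemma dual_continuous (f : D) : continuous (f : X -> R).
Proof. by case: f => f /= /set_mem[]. Qed.

HB.instance Definition _ (f : D) :=
  GRing.isLinear.Build R X R _ (dual_val f) (dual_linear f).

Definition unit_ball : set X := [set x | `|x| <= 1].

Lemma dual_bounded (f : D) : bounded_on unit_ball f.
Proof.
have /linear_boundedP/pinfty_ex_gt0[r r0 fr] : bounded_near f (nbhs (0 : X)).
  exact/linear_bounded_continuous/dual_continuous.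
apply/bounded_onP; exists r => x x1; rewrite (le_trans (fr x))//.
by rewrite -[leRHS]mulr1 ler_wpM2l// ltW.
Qed.

Definition dual_norm (f : D) : R := sup_norm unit_ball f.

Lemma dual_norm_le (f : D) x : `|f x| <= dual_norm f * `|x|.
Proof.
have [->|x0] := eqVneq x 0; first by rewrite linear0 !normr0 mulr0.
have nx0 : 0 < `|x| by rewrite normr_gt0.
rewrite -ler_pdivrMr// mulrC -[X in X * _]ger0_norm ?invr_ge0//.
rewrite -normrM -[_^-1 * _]/(_ *: _) -linearZ sup_norm_ub//=.
  exact: dual_bounded.
by rewrite /unit_ball /= normrZ ger0_norm ?invr_ge0// mulVf// gt_eqF.
Qed.

Lemma dual_normD (f g : D) : dual_norm (f + g) <= dual_norm f + dual_norm g.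
Proof. by apply: sup_normD; exact: dual_bounded. Qed.

Lemma dual_normZ (a : R) (f : D) : dual_norm (a *: f) = `|a| * dual_norm f.
Proof. by apply: sup_normZ; exact: dual_bounded. Qed.

Lemma dual_norm_eq0 (f : D) : dual_norm f = 0 -> f = 0.
Proof.
move=> f0; apply/val_inj/funext => x /=; apply/eqP.
by rewrite -normr_le0 (le_trans (dual_norm_le f x))// f0 mul0r.
Qed.

HB.instance Definition _ := Lmodule_isNormed.Build R D
  dual_normD dual_normZ dual_norm_eq0.

Lemma dual_normE (f : D) : `|f| = sup_norm unit_ball f.
Proof. by []. Qed.

End Dual.

Definition weak_star (R : realType) (X : normedModType R) : topologicalType :=
  initial_topology (fun f : dual X => (f : {ptws X -> R})).

Definition dual_ball (R : realType) (X : normedModType R) : Type :=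
  set_type [set f : weak_star X | `|f : dual X| <= 1].

HB.instance Definition _ (R : realType) (X : normedModType R) :=
  Topological.on (dual_ball X).

Definition dual_of_ball (R : realType) (X : normedModType R)
  (f : dual_ball X) : dual X := val f.
Coercion dual_of_ball : dual_ball >-> dual.

Lemma dual_ballP (R : realType) (X : normedModType R) (f : dual_ball X) :
  `|f : dual X| <= 1.
Proof. exact: (set_mem (valP f)). Qed.

Lemma dual_ball0 (R : realType) (X : normedModType R) :
  (0 : dual X) \in [set f : weak_star X | `|f : dual X| <= 1].
Proof. by apply/mem_set; rewrite /= normr0. Qed.

HB.instance Definition _ (R : realType) (X : normedModType R) :=
  isPointed.Build (dual_ball X) (SigSub (dual_ball0 X)).

Definition linfty_c (R : realType) (G : Type) : set (linfty R G) :=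
  [set f | countable [set g | f g != 0]].

(* [weak_star X] and [dual X] have the same carrier: the first continuity
   condition is for the norm topologies, the last one for the weak-star and
   pointwise topologies. *)
Definition WLD (R : realType) (X : completeNormedModType R) : Prop :=
  exists (G : Type) (Phi : {linear dual X -> linfty R G}),
    [/\ inhabited G, continuous Phi, injective Phi,
        forall f, linfty_c (Phi f) &
        continuous (fun f : weak_star X => Phi f : {ptws G -> R})].

Section PropertyM.
Context {R : realType} {K : ptopologicalType}.
Notation Borel := (g_sigma_algebraType (@open K)).
Implicit Types mu : probability Borel R.
Local Open Scope ereal_scope.

(* Inner regularity by compact sets and outer regularity by open sets; meant
   for compact Hausdorff [K], where compact sets are Borel. *)
Definition regular_measure mu := forall A : set Borel, measurable A ->
  mu A = ereal_sup [set mu C | C in [set C : set K | compact C /\ C `<=` A]] /\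
  mu A = ereal_inf [set mu U | U in [set U : set K | open U /\ A `<=` U]].

Definition measure_support mu : set K :=
  [set x : K | forall U : set K, open U -> U x -> 0 < mu U].

End PropertyM.

Definition separable_set (T : topologicalType) (S : set T) : Prop :=
  exists D : set T, [/\ countable D, D `<=` S & S `<=` closure D].

Definition property_M (R : realType) (K : ptopologicalType) : Prop :=
  forall mu : probability (g_sigma_algebraType (@open K)) R,
    regular_measure mu -> separable_set (measure_support mu).

Section Tensor.
Context {R : realType} (X Y : completeNormedModType R).
Notation B := (dual_ball X * dual_ball Y)%type.

Lemma elem_tensor_bounded (x : X) (y : Y) :
  (fun fg : B => fg.1 x * fg.2 y) \in linfty_pred R B.
Proof.
apply/mem_set/bounded_onP; exists (`|x| * `|y|) => -[f g] _ /=.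
rewrite normrM ler_pM//.
  by rewrite (le_trans (dual_norm_le f x))// ler_piMl// dual_ballP.
by rewrite (le_trans (dual_norm_le g y))// ler_piMl// dual_ballP.
Qed.

(* A tensor in the algebraic tensor product of X and Y is identified with the
   function it induces on the product of the dual balls,
     sum_i x_i (x) y_i |-> ((f, g) |-> sum_i f(x_i) g(y_i)).
   This is injective, since the dual balls separate points, and the injective
   norm of a tensor is the supremum norm of that function (see
   [alg_tensor_normE] below). The completion [inj_tensor] is therefore the
   closure of these functions in the Banach space of bounded functions. *)
Definition elem_tensor (x : X) (y : Y) : linfty R B :=
  Linfty (elem_tensor_bounded x y).

Definition alg_tensor : set (linfty R B) :=
  [set u | exists n (x : 'I_n -> X) (y : 'I_n -> Y),
     u = \sum_(i < n) elem_tensor (x i) (y i)].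

Lemma alg_tensor_normE n (x : 'I_n -> X) (y : 'I_n -> Y) :
  `|\sum_(i < n) elem_tensor (x i) (y i)| =
  sup [set `|\sum_(i < n) fg.1 (x i) * fg.2 (y i)| | fg in [set: B]].
Proof.
rewrite linfty_normE /sup_norm; congr sup; apply: eq_imagel => fg _.
have -> : linfty_val (\sum_(i < n) elem_tensor (x i) (y i)) =
    \sum_(i < n) linfty_val (elem_tensor (x i) (y i)).
  exact: (@big_morph _ _ (@linfty_val R B) 0 +%R).
by rewrite fct_sumE.
Qed.

Definition inj_tensor_pred : {pred linfty R B} := mem (closure alg_tensor).

Record inj_tensor := InjTensor {
  inj_tensor_val :> linfty R B ;
  _ : inj_tensor_val \in inj_tensor_pred }.

HB.instance Definition _ := [isSub for inj_tensor_val].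
HB.instance Definition _ := [Choice of inj_tensor by <:].

Lemma alg_tensor0 : alg_tensor 0.
Proof. by exists 0%N, (fun=> 0), (fun=> 0); rewrite big_ord0. Qed.

Lemma alg_tensorD u v : alg_tensor u -> alg_tensor v -> alg_tensor (u + v).
Proof.
move=> [n [x [y ->]]] [m [x' [y' ->]]].
exists (n + m)%N,
  (fun i : 'I_(n + m) => match fintype.split i with inl j => x j | inr k => x' k end),
  (fun i : 'I_(n + m) => match fintype.split i with inl j => y j | inr k => y' k end).
rewrite big_split_ord /=; congr (_ + _); apply: eq_bigr => i _.
  by have := unsplitK (inl i : 'I_n + 'I_m) => /= ->.
by have := unsplitK (inr i : 'I_n + 'I_m) => /= ->.
Qed.

Lemma elem_tensorZl a x y : elem_tensor (a *: x) y = a *: elem_tensor x y.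
Proof.
apply/val_inj/funext => fg; rewrite [LHS]/= linearZ /=; exact: (esym (mulrA _ _ _)).
Qed.

Lemma alg_tensorZ a u : alg_tensor u -> alg_tensor (a *: u).
Proof.
move=> [n [x [y ->]]]; exists n, (fun i => a *: x i), y.
by rewrite scaler_sumr; apply: eq_bigr => i _; rewrite elem_tensorZl.
Qed.

Lemma inj_tensor_submod_closed : submod_closed inj_tensor_pred.
Proof.
split; first by apply/mem_set/subset_closure; exact: alg_tensor0.
move=> a u v /set_mem cu /set_mem cv; apply/mem_set => V.
have /= addZ : {for (u, v), continuous (fun w : linfty R B * linfty R B => a *: w.1 + w.2)}.
  apply: cvgD; last exact: cvg_snd.
  by apply: cvgZr; exact: cvg_fst.
move=> /addZ[/= [U1 U2]] /= [/cu[u' [tu' Uu']] /cv[v' [tv' Uv']]] sub.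
exists (a *: u' + v'); split; last exact: (sub (u', v')).
by apply: alg_tensorD => //; exact: alg_tensorZ.
Qed.

HB.instance Definition _ := GRing.isSubmodClosed.Build R (linfty R B)
  inj_tensor_pred inj_tensor_submod_closed.
HB.instance Definition _ := [SubChoice_isSubLmodule of inj_tensor by <:].

Lemma inj_tensorP (u : inj_tensor) : closure alg_tensor (u : linfty R B).
Proof. by case: u => u /= /set_mem. Qed.

Definition inj_tensor_norm (u : inj_tensor) : R := `|u : linfty R B|.

Lemma inj_tensor_normD (u v : inj_tensor) :
  inj_tensor_norm (u + v) <= inj_tensor_norm u + inj_tensor_norm v.
Proof. exact: ler_normD. Qed.

Lemma inj_tensor_normZ (a : R) (u : inj_tensor) :
  inj_tensor_norm (a *: u) = `|a| * inj_tensor_norm u.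
Proof. exact: normrZ. Qed.

Lemma inj_tensor_norm_eq0 (u : inj_tensor) : inj_tensor_norm u = 0 -> u = 0.
Proof. by move=> /normr0_eq0 u0; exact: val_inj. Qed.

HB.instance Definition _ := Lmodule_isNormed.Build R inj_tensor
  inj_tensor_normD inj_tensor_normZ inj_tensor_norm_eq0.

Lemma inj_tensor_complete (F : set_system inj_tensor) :
  ProperFilter F -> cauchy F -> cvg F.
Proof.
move=> FF Fc; pose G := (fun u : inj_tensor => (u : linfty R B)) @ F.
have : cvg G.
  apply: cauchy_cvg; apply: (@cauchyP _ _ _ _).2 => e e0.
  have [u Fu] := (@cauchyP _ _ F FF).1 Fc e e0.
  exists (u : linfty R B); apply: (@filterS _ F _ (ball u e)) => [h|//].
  by rewrite -!ball_normE.
move=> /cvg_ex[l Gl].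
have tl : l \in inj_tensor_pred.
  apply/mem_set; apply: closed_closure => V /Gl FV; have [u uV] := @filter_ex _ F _ _ FV.
  by exists (u : linfty R B); split => //; exact: inj_tensorP.
apply/cvg_ex; exists (InjTensor tl); apply/cvgrPdist_le => e e0.
by have /cvgrPdist_le/(_ _ e0) := Gl.
Qed.

HB.instance Definition _ :=
  Uniform_isComplete.Build inj_tensor inj_tensor_complete.

End Tensor.

(* Main.v *)
Require Import Defs.
From HB Require Import structures.
From mathcomp Require Import all_boot all_order all_algebra.
From mathcomp Require Import all_classical all_reals all_analysis.
From mathcomp Require Import lra ring.

(* A WLD space X carries a bounded family (x_g) that separates the points of X^*
   and such that every functional vanishes on all but countably many x_g; the
   functionals f |-> f(x_g) are the coordinates of the given injection, which are
   evaluations because they are weak-star continuous.  With such families in X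
   and Y, the tensors x_g (x) y_h separate the functionals on the injective tensor
   product, and each functional phi has countably many nonzero phi(x_g (x) y_h)
   in each row and in each column, as phi(x (x) .) and phi(. (x) y) are functionals
   on Y and X.  It remains to see that only countably many rows (if the ball of
   X^* has property (M)) are nonzero.  Extend phi to bounded functions on the
   product of the balls by Hahn-Banach; the total variation of the extension,
   pushed to the ball of X^*, is a finitely additive measure, which is dominated
   on compact sets by a regular Borel measure.  The support of that measure has a
   countable dense subset D, and phi(x (x) .) = 0 whenever all f in D vanish
   at x. *)

Set Implicit Arguments.
Unset Strict Implicit.
Unset Printing Implicit Defensive.

Import Order.TTheory GRing.Theory Num.Theory.
Import numFieldNormedType.Exports.

Local Open Scope classical_set_scope.
Local Open Scope ring_scope.

(** * The Hahn-Banach theorem *)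

Section HahnBanach.
Context {R : realType}.

Definition sublinear (V : lmodType R) (p : V -> R) :=
  (forall u v, p (u + v) <= p u + p v) /\
  (forall t v, 0 < t -> p (t *: v) <= t * p v).

Section Sublinear.
Context {V : lmodType R}.
Implicit Types p q : V -> R.

Lemma sublinear0 p : sublinear p -> p 0 = 0.
Proof.
move=> [pD pZ]; have := pD 0 0; have := pZ 2^-1 0.
by rewrite addr0 scaler0 invr_gt0 ltr0n => /(_ isT); lra.
Qed.

Lemma sublinearN p v : sublinear p -> - p (- v) <= p v.
Proof. by move=> sp; have := sp.1 v (- v); rewrite subrr sublinear0//; lra. Qed.

(** Lower bounds of chains for Zorn's lemma. The infimum is finite because a member [q] satisfies
    [- p (- v) <= - q (- v) <= q v]. It is subadditive because, of a member used at [u] and one used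
    at [v], the smaller serves at both. *)
Lemma sublinear_inf_chain p (A : set (V -> R)) : A !=set0 ->
  (forall q, A q -> sublinear q /\ forall v, q v <= p v) ->
  (forall q r, A q -> A r -> (forall v, q v <= r v) \/ (forall v, r v <= q v)) ->
  let i v := inf [set q v | q in A] in
  sublinear i /\ forall q, A q -> forall v, i v <= q v.
Proof.
move=> [q0 Aq0] Asub tot i.
have iA q : A q -> forall v, i v <= q v.
  move=> Aq v; apply: ge_inf; last by exists q.
  exists (- p (- v)) => _ [r Ar <-]; have [sr rp] := Asub r Ar.
  by rewrite (le_trans _ (sublinearN v sr))// lerN2 rp.
have lbA x v : (forall q, A q -> x <= q v) -> x <= i v.
  move=> xq; apply: lb_le_inf; first by exists (q0 v), q0.
  by move=> _ [q Aq <-]; exact: xq.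
split=> //; split=> [u v|t v t0].
  rewrite -lerBlDl; apply: (lbA) => q Aq; rewrite lerBlDl -lerBlDr.
  apply: (lbA) => r Ar; rewrite lerBlDr.
  have [le_qr|le_rq] := tot q r Aq Ar.
    by rewrite (le_trans (iA q Aq _))// (le_trans ((Asub q Aq).1.1 _ _))// lerD2r.
  by rewrite (le_trans (iA r Ar _))// (le_trans ((Asub r Ar).1.1 _ _))// lerD2l.
rewrite mulrC -ler_pdivrMr//; apply: (lbA) => q Aq.
by rewrite ler_pdivrMr// mulrC (le_trans (iA q Aq _))// (Asub q Aq).1.2.
Qed.

Lemma sublinearZ p t v : sublinear p -> 0 <= t -> p (t *: v) = t * p v.
Proof.
move=> sp; rewrite le0r => /orP[/eqP ->|t0].
  by rewrite mul0r scale0r sublinear0.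
apply/eqP; rewrite eq_le sp.2//= -ler_pdivlMl//.
by rewrite (le_trans _ (sp.2 _ _ _)) ?invr_gt0// scalerA mulVf ?scale1r// gt_eqF.
Qed.

(** The witness is the infimum over [t >= 0] of [q (v + t *: w) - t * q w]; the two bounds are the
    values at [t = 0] and [t = 1]. Subadditivity of [q] bounds it below by [- q (- v)]. *)
Lemma sublinear_shift q w : sublinear q -> exists r, [/\ sublinear r,
  forall v, r v <= q v & forall v, r v <= q (v + w) - q w].
Proof.
move=> sq; pose E v := [set q (v + t *: w) - t * q w | t in [set t : R | 0 <= t]].
have lbE v : lbound (E v) (- q (- v)).
  move=> _ [t /= t0 <-]; rewrite -(sublinearZ w sq t0).
  have := sq.1 (v + t *: w) (- v).
  by rewrite addrAC subrr add0r; lra.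
have infE t v : 0 <= t -> inf (E v) <= q (v + t *: w) - t * q w.
  by move=> t0; apply: ge_inf; [exists (- q (- v))|exists t].
have lb_inf x v : (forall t, 0 <= t -> x <= q (v + t *: w) - t * q w) -> x <= inf (E v).
  move=> xq; apply: lb_le_inf; first by exists (q (v + 0 *: w) - 0 * q w), 0 => /=.
  by move=> _ [t t0 <-]; exact: xq.
exists (fun v => inf (E v)); split=> [|v|v].
- split=> [u v|c v c0].
    rewrite -lerBlDl; apply: (lb_inf) => s s0; rewrite lerBlDl -lerBlDr.
    apply: (lb_inf) => t t0; rewrite lerBlDr.
    rewrite (le_trans (infE (t + s) _ _)) ?addr_ge0// scalerDl addrACA.
    by have := sq.1 (u + t *: w) (v + s *: w); lra.
  rewrite mulrC -ler_pdivrMr//; apply: (lb_inf) => t t0.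
  rewrite ler_pdivrMr// mulrC (le_trans (infE (c * t) _ (mulr_ge0 (ltW c0) t0)))//.
  by rewrite -scalerA -scalerDr mulrBr mulrA lerD2r sq.2.
- by rewrite (le_trans (infE 0 _ _))// scale0r addr0 mul0r subr0.
- by rewrite (le_trans (infE 1 _ _))// scale1r mul1r.
Qed.

(* A sublinear functional that is minimal below [p] is linear: it cannot be
   lowered to the functional of [sublinear_shift]. *)
Lemma sublinear_ge_linear p : sublinear p ->
  exists f : {linear V -> R}, forall v, f v <= p v.
Proof.
move=> sp; pose T := {q : V -> R | sublinear q /\ forall v, q v <= p v}.
(* The order is reversed, so that a maximal element for Zorn's lemma is a minimal functional. *)
pose below (q r : T) := `[< forall v, sval r v <= sval q v >].
have [|q r s /asboolP qr /asboolP rs|A Atot|[q [sq qp]] qmin] :=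
    @ZL_preorder T (exist _ p (conj sp (fun=> lexx _))) below.
- by move=> q; apply/asboolP.
- by apply/asboolP => v; exact: le_trans (rs v) (qr v).
- have [->|/set0P[q0 Aq0]] := eqVneq A set0.
    by exists (exist _ p (conj sp (fun=> lexx _))).
  have := @sublinear_inf_chain p (sval @` A).
  case=> [|_ [q _ <-]|_ _ [q Aq <-] [r Ar <-]|si iA].
  + by exists (sval q0), q0.
  + exact: svalP q.
  + by have [/asboolP|/asboolP] := Atot q r Aq Ar; [right|left].
  unshelve eexists.
    exists (fun v => inf [set q v | q in sval @` A]); split=> // v.
    apply: le_trans (iA (sval q0) _ v) _; first by exists q0.
    by have [_ ->] := svalP q0.
  by move=> q Aq; apply/asboolP => v; apply: iA; exists q.
have qD u v : q (u + v) = q u + q v.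
  apply/eqP; rewrite eq_le sq.1/=.
  have [r [sr rq rw]] := sublinear_shift v sq.
  have rT : sublinear r /\ forall w, r w <= p w.
    by split=> // w; exact: le_trans (rq w) (qp w).
  (* Minimality gives [q u <= r u <= q (u + v) - q v]. *)
  have /asboolP/(_ u) /= := qmin (exist _ r rT) (introT (asboolP _) rq).
  by have := rw u; lra.
have qN v : q (- v) = - q v.
  by apply/eqP; rewrite -addr_eq0 -qD addNr sublinear0.
have qlin : linear (q : V -> R).
  move=> c u v; rewrite qD; congr (_ + _); have [c0|c0] := leP 0 c.
    exact: sublinearZ.
  rewrite -[c]opprK scaleNr qN sublinearZ ?oppr_ge0 1?ltW//.
  by rewrite -mulNr.
pose Q := GRing.isLinear.Build R V R _ q qlin.
by pose g : {linear V -> R} := HB.pack q Q; exists g.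
Qed.

End Sublinear.

(** No step-by-step extension: any linear [g] below the sublinear functional
    [v |-> inf_w (f w + C * |v - j w|)] works. Taking [w = 0] gives the bound by [C], and the point
    [j w] gives [g (j w) <= f w], which is an equality because it also holds at [- w]. *)
Lemma hahn_banach (W V : normedModType R) (j : {linear W -> V})
    (f : {linear W -> R}) (C : R) : 0 <= C ->
    (forall w, `|f w| <= C * `|j w|) ->
  exists g : {linear V -> R}, (forall w, g (j w) = f w) /\
    forall v, `|g v| <= C * `|v|.
Proof.
move=> C0 fC; pose E v := [set f w + C * `|v - j w| | w in [set: W]].
have lbE v : lbound (E v) (- (C * `|v|)).
  move=> _ [w _ <-]; have := ler_norm (- f w); rewrite normrN.
  have := ler_wpM2l C0 (ler_normB v (v - j w)); rewrite mulrDr subKr.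
  by have := fC w; lra.
have infE w v : inf (E v) <= f w + C * `|v - j w|.
  by apply: ge_inf; [exists (- (C * `|v|))|exists w].
have lb_inf x v : (forall w, x <= f w + C * `|v - j w|) -> x <= inf (E v).
  move=> xq; apply: lb_le_inf; first by exists (f 0 + C * `|v - j 0|), 0.
  by move=> _ [w _ <-]; exact: xq.
have [|g gE] := @sublinear_ge_linear V (fun v => inf (E v)).
  split=> [u v|c v c0].
    rewrite -lerBlDl; apply: (lb_inf) => w; rewrite lerBlDl -lerBlDr.
    apply: (lb_inf) => w'; rewrite lerBlDr.
    rewrite (le_trans (infE (w' + w) _))// (linearD f) (linearD j) opprD [u + v + _]addrACA.
    by have := ler_wpM2l C0 (ler_normD (u - j w') (v - j w)); lra.
  rewrite mulrC -ler_pdivrMr//; apply: (lb_inf) => w.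
  rewrite ler_pdivrMr// mulrC (le_trans (infE (c *: w) _))// linearZ [j _]linearZ /=.
  rewrite -scalerBr normrZ (gtr0_norm c0) mulrDr.
  by rewrite mulrCA lexx.
have gC v : g v <= C * `|v|.
  by rewrite (le_trans (gE v))// (le_trans (infE 0 v))// (linear0 f) (linear0 j) subr0 add0r.
have gj w : g (j w) <= f w.
  by rewrite (le_trans (gE _))// (le_trans (infE w _))// subrr normr0 mulr0 addr0.
exists g; split=> [w|v].
  apply/eqP; rewrite eq_le gj /= -lerN2 -!linearN /=; exact: gj.
rewrite ler_norml gC andbT lerNl -linearN /= -[`|v|]normrN; exact: gC.
Qed.

End HahnBanach.

(** * Regular Borel probabilities from finitely additive set functions *)

Section RegularContent.
Context {R : realType} {K : ptopologicalType} (m : set K -> R).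
Hypotheses (hausK : hausdorff_space K) (compK : compact [set: K]).
Hypothesis m_le : forall A B, A `<=` B -> m A <= m B.
Hypothesis mU : forall A B, m (A `|` B) <= m A + m B.
Hypothesis mD : forall A B, A `&` B = set0 -> m A + m B <= m (A `|` B).
Hypothesis mT : m setT = 1.
Local Open Scope ereal_scope.

Let m0 : m set0 = 0%R.
Proof. by have := mD (set0I set0); have := mU set0 set0; rewrite setU0; lra. Qed.

Let closed_compact (C : set K) : closed C -> compact C.
Proof. by move=> cC; exact: subclosed_compact cC compK _. Qed.

(** As in the Riesz-Markov construction: [lam] measures open sets from inside by closed sets, and
    the outer measure [mu] measures all sets from outside by open ones. *)
Let lam (U : set K) :=
  ereal_sup [set (m C)%:E | C in [set C | closed C /\ C `<=` U]].

Let mu (A : set K) := ereal_inf [set lam U | U in [set U | open U /\ A `<=` U]].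

Let lam_ge C U : closed C -> C `<=` U -> (m C)%:E <= lam U.
Proof. by move=> cC CU; apply: ereal_sup_ubound; exists C. Qed.

Let lam_lub U x : (forall C, closed C -> C `<=` U -> (m C)%:E <= x) -> lam U <= x.
Proof. by move=> Ux; apply: ge_ereal_sup => _ [C [cC CU] <-]; exact: Ux. Qed.

Let lam_le U V : U `<=` V -> lam U <= lam V.
Proof.
by move=> UV; apply: lam_lub => C cC CU; apply: lam_ge => //; exact: subset_trans UV.
Qed.

Let lam_ge0 U : 0 <= lam U.
Proof.
by rewrite -[X in X <= _]/(0%R%:E) -m0; apply: lam_ge; [exact: closed0|exact: sub0set].
Qed.

Let lam_le1 U : lam U <= 1.
Proof. by apply: lam_lub => C _ _; rewrite -[1]/(1%R%:E) -mT lee_fin m_le. Qed.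

Let mu_lb U A : open U -> A `<=` U -> mu A <= lam U.
Proof. by move=> oU AU; apply: ereal_inf_lbound; exists U. Qed.

Let mu_glb A x : (forall U, open U -> A `<=` U -> x <= lam U) -> x <= mu A.
Proof. by move=> Ux; apply: le_ereal_inf_tmp => _ [U [oU AU] <-]; exact: Ux. Qed.

Let mu_open U : open U -> mu U = lam U.
Proof.
move=> oU; apply/eqP; rewrite eq_le mu_lb//=.
by apply: mu_glb => V _; exact: lam_le.
Qed.

Let mu_le A B : A `<=` B -> mu A <= mu B.
Proof.
by move=> AB; apply: mu_glb => U oU BU; apply: mu_lb => //; exact: subset_trans BU.
Qed.

Let mu_ge0 A : 0 <= mu A.
Proof. by apply: mu_glb => U _ _; exact: lam_ge0. Qed.

Let mu_fin A : mu A \is a fin_num.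
Proof.
rewrite ge0_fin_numE// (@le_lt_trans _ _ 1) ?ltry//.
by rewrite (le_trans (mu_lb openT (@subsetT _ A))).
Qed.

Let mu0 : mu set0 = 0.
Proof.
apply/eqP; rewrite eq_le mu_ge0 andbT mu_open; last exact: open0.
by apply: lam_lub => C _; rewrite subset0 => ->; rewrite m0.
Qed.

Let muT : mu setT = 1.
Proof.
rewrite mu_open; last exact: openT.
apply/eqP; rewrite eq_le lam_le1 /= -[1]/(1%R%:E) -mT.
by apply: lam_ge => //; exact: closedT.
Qed.

(* By normality a closed subset of [U_0 `|` ... `|` U_n] is covered by a closed
   subset of [U_n] and a closed subset of the union of the other sets. *)
Let lam_bigcup_ord n C (U : nat -> set K) : closed C -> (forall i, open (U i)) ->
  C `<=` \bigcup_(i in `I_n) U i -> (m C)%:E <= \sum_(i < n) lam (U i).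
Proof.
move=> + oU; elim: n C => [C _|n IHn C cC CU].
  by rewrite II0 bigcup_set0 subset0 => ->; rewrite m0 big_ord0.
have cCU : closed (C `&` ~` U n) by apply: closedI => //; exact: open_closedC.
pose W := \bigcup_(i in `I_n) U i.
have [|N /set_nbhsP[B [oB CB BN]] NW] := compact_normal hausK compK cCU (_ : set_nbhs _ W).
  apply/set_nbhsP; exists W; split=> //; first exact: bigcup_open.
  move=> x [/CU[i /= + Ux] nUx]; rewrite ltnS leq_eqVlt => /orP[/eqP iE|]; last by exists i.
  by rewrite iE in Ux.
have C_sub : C `<=` (C `&` closure N) `|` (C `&` ~` B).
  move=> x Cx; have [Bx|nBx] := pselect (B x); last by right.
  by left; split=> //; apply/subset_closure/BN.
rewrite big_ord_recr /= (@le_trans _ _ (m (C `&` closure N) + m (C `&` ~` B))%:E)//.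
  by rewrite lee_fin (le_trans (m_le C_sub)).
rewrite EFinD leeD//.
  by apply: IHn; [exact: closedI cC (@closed_closure _ N)|move=> x [_ /NW]].
apply: lam_ge; first by apply: closedI => //; exact: open_closedC.
by move=> x [Cx nBx]; apply: contrapT => nUx; apply: nBx; exact: CB.
Qed.

Let lam_bigcup (U : nat -> set K) : (forall i, open (U i)) ->
  lam (\bigcup_i U i) <= \sum_(i <oo) lam (U i).
Proof.
move=> oU; apply: lam_lub => C cC CU.
have := closed_compact cC; rewrite compact_cover => /(_ _ setT U (fun i _ => oU i) CU).
(* The indices of the finite subcover all lie below [n], so the finite case applies to an initial
   segment. *)
move=> [D _ CD]; pose n := (\max_(i <- finmap.enum_fset D) i).+1.
apply: (@le_trans _ _ (\sum_(i < n) lam (U i))).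
  apply: lam_bigcup_ord => // x /CD[i /= iD Ux]; exists i => //=.
  by rewrite /n ltnS; exact: (@leq_bigmax_seq _ (finmap.enum_fset D) xpredT id).
by rewrite -(big_mkord xpredT (fun i => lam (U i))); exact: nneseries_lim_ge.
Qed.

Let mu_sigma_subadditive : sigma_subadditive mu.
Proof.
move=> A; apply/lee_addgt0Pr => e e0; pose d i := (e / (2 ^ i.+1)%:R)%R.
have d0 i : (0 < d i)%R by rewrite divr_gt0// ltr0n expn_gt0.
have /choice[U UA] i : exists U, [/\ open U, A i `<=` U & lam U <= mu (A i) + (d i)%:E].
  have [_ [U [oU AU] <-] lt_U] := lb_ereal_inf_adherent (d0 i) (mu_fin (A i)).
  by exists U; split=> //; exact: ltW.
apply: (@le_trans _ _ (lam (\bigcup_i U i))).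
  apply: mu_lb; first by apply: bigcup_open => i _; have [] := UA i.
  by apply: subset_bigcup => i _; have [] := UA i.
apply: le_trans (lam_bigcup _) _; first by move=> i; have [] := UA i.
apply: le_trans (epsilon_trick xpredT _ (ltW e0)) => //.
by apply: lee_nneseries => // i _; have [] := UA i.
Qed.

Let mu_outer : {outer_measure set K -> \bar R} :=
  HB.pack mu (isOuterMeasure.Build R K mu mu0 mu_ge0 mu_le mu_sigma_subadditive).

(** For open [U] containing [X], choose a closed [C] inside [U] and [V], then a closed [D] inside
    [U] minus [C]. They are disjoint, so [m C + m D <= lam U]; suprema over [D] and then [C] give
    the splitting inequality. *)
Let open_caratheodory V : open V -> mu_outer.-caratheodory V.
Proof.
move=> oV; apply: le_caratheodory_measurable => X.
apply: mu_glb => U oU XU.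
apply: (@le_trans _ _ (lam (U `&` V) + mu (U `&` ~` V))).
  apply: leeD; last by apply: mu_le; exact: setSI.
  by apply: mu_lb; [exact: openI|exact: setSI].
rewrite -leeBrDr; last exact: mu_fin.
apply: lam_lub => C cC CUV; rewrite leeBrDr ?mu_fin// addeC -leeBrDr//.
apply: (@le_trans _ _ (lam (U `&` ~` C))).
  apply: mu_lb; first by apply: openI => //; exact: closed_openC.
  by move=> x [Ux nVx]; split=> // /CUV[].
apply: lam_lub => D cD DUC; rewrite leeBrDr// -EFinD.
apply: le_trans (_ : (m (D `|` C))%:E <= _).
  by rewrite lee_fin mD// -subset0 => x [/DUC[_ /=]].
apply: lam_ge; first exact: closedU.
by move=> x [/DUC[]//|/CUV[]].
Qed.

Let Borel := g_sigma_algebraType (@open K).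

Let borel_caratheodory (A : set Borel) : measurable A -> mu_outer.-caratheodory A.
Proof.
apply: smallest_sub; last by move=> U; exact: open_caratheodory.
split; first exact: caratheodory_measurable_set0.
- by move=> B mB; rewrite setTD; exact: caratheodory_measurable_setC.
- exact: caratheodory_measurable_bigcup.
Qed.

Let mu_sigma_additive : semi_sigma_additive (mu : set Borel -> \bar R).
Proof.
move=> A mA tA mAU; apply: (@caratheodory_measure_sigma_additive _ _ mu_outer) => //.
  by move=> i; exact: borel_caratheodory.
exact: borel_caratheodory.
Qed.

(** [P] need not extend [m]; the one-sided comparison suffices to transfer null sets from [P] to
    [m], and it is immediate from the definition of [lam]. *)
Lemma regular_probability_of_content :
  exists2 P : probability (g_sigma_algebraType (@open K)) R,
    regular_measure P &
    forall C U : set K, closed C -> open U -> C `<=` U -> (m C)%:E <= P U.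
Proof.
pose M := isMeasure.Build _ Borel R mu mu0 mu_ge0 mu_sigma_additive.
pose muM : {measure set Borel -> \bar R} := HB.pack mu M.
pose MP := Measure_isProbability.Build _ Borel R muM muT.
pose P : probability Borel R := HB.pack (mu : set Borel -> \bar R) M MP.
exists P; last by move=> C U cC oU CU; rewrite /P/= mu_open//; exact: lam_ge.
have outerP (A : set Borel) :
    P A = ereal_inf [set P U | U in [set U : set K | open U /\ A `<=` U]].
  by congr ereal_inf; apply: eq_imagel => U [oU _]; rewrite -[RHS]/(mu U) mu_open.
move=> A mA; split=> //; apply/eqP; rewrite eq_le; apply/andP; split; last first.
  by apply: ge_ereal_sup => _ [C [_ CA] <-]; exact: mu_le.
apply/lee_addgt0Pr => e e0.
(* Inner regularity at [A] is outer regularity at its complement: if the open [U] nearly fits the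
   complement of [A], then the complement of [U] is compact and nearly fills [A]. *)
have [_ [U [oU AU] <-] lt_U] := lb_ereal_inf_adherent e0 (mu_fin (~` A)).
have mU' : measurable (U : set Borel) by exact: sub_sigma_algebra.
have : P (~` U) <= ereal_sup [set P C | C in [set C : set K | compact C /\ C `<=` A]].
  apply: ereal_sup_ubound; exists (~` U) => //; split.
    by apply: closed_compact; exact: open_closedC.
  by rewrite -[A]setCK; exact: subsetC.
move=> /(leeD2r e%:E); apply: le_trans.
have : P U <= P (~` A) + e%:E by rewrite -[P U]/(mu U) mu_open// ltW.
rewrite !probability_setC// -[P U]fineK ?mu_fin// -[P A]fineK ?mu_fin//.
by rewrite -!EFinB -!EFinD !lee_fin; lra.
Qed.

End RegularContent.

(** * Functionals on bounded functions and property (M) *)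

Section Variation.
Context {R : realType} {K B : Type} (pi : B -> K).
Context (F : {linear linfty R B -> R}) (c : R).
Hypothesis F_le : forall g, `|F g| <= c * `|g|.
Implicit Types (A : set K) (g : linfty R B).

Lemma restrict_bounded A g :
  (fun b => if `[< A (pi b) >] then g b else 0) \in linfty_pred R B.
Proof.
apply/mem_set/bounded_onP; exists `|g| => b _.
by case: asboolP => _; [exact: linfty_ub|rewrite normr0].
Qed.

Definition linfty_restrict A g : linfty R B := Linfty (restrict_bounded A g).

Lemma linfty_norm_le (g : linfty R B) (M : R) : 0 <= M -> (forall b, `|g b| <= M) -> `|g| <= M.
Proof. by move=> M0 gM; apply: sup_norm_le => // b _; exact: gM. Qed.

(* Total variation over [pi @^-1` A] of [F], seen as a finitely additive measure. *)
Definition variation A : R :=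
  sup [set F g | g in [set g : linfty R B | `|g| <= 1 /\ forall b, ~ A (pi b) -> g b = 0]].

Lemma variation_ge A g : `|g| <= 1 -> (forall b, ~ A (pi b) -> g b = 0) ->
  F g <= variation A.
Proof.
move=> g1 gA; apply: ub_le_sup; last by exists g.
exists `|c| => _ [h [h1 _] <-]; rewrite (le_trans (ler_norm _))//.
by rewrite (le_trans (F_le h))// (le_trans (ler_norm _))// normrM normr_id ler_piMr.
Qed.

Lemma variation_le A (x : R) :
  (forall g, `|g| <= 1 -> (forall b, ~ A (pi b) -> g b = 0) -> F g <= x) ->
  variation A <= x.
Proof.
move=> Ax; apply: ge_sup => [|_ [g [g1 gA] <-]]; last exact: Ax.
by exists (F 0), 0; split=> //; rewrite normr0 ler01.
Qed.

Lemma variation_subset A A' : A `<=` A' -> variation A <= variation A'.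
Proof.
move=> AA'; apply: variation_le => g g1 gA; apply: variation_ge => // b nA'.
by apply: gA => /AA'.
Qed.

(** A test function on the union is the sum of its restriction to [A] and a remainder that vanishes
    off [A'], both of norm at most 1. *)
Lemma variationU A A' : variation (A `|` A') <= variation A + variation A'.
Proof.
apply: variation_le => g g1 gAA'; pose h := linfty_restrict A g.
rewrite -(subrK h g) addrC linearD lerD//; apply: variation_ge => [|b].
- apply: linfty_norm_le => // b; rewrite /h/=.
  by case: asboolP => _; rewrite ?normr0// (le_trans (linfty_ub g b)).
- by move=> nA; rewrite /h/=; case: asboolP.
- apply: linfty_norm_le => // b; rewrite linfty_distE /h/=.
  by case: asboolP => _; rewrite ?subrr ?subr0 ?normr0// (le_trans (linfty_ub g b)).
- move=> nA'; rewrite linfty_distE /h/=; case: asboolP => [_|nA].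
    by rewrite subrr.
  by rewrite subr0 gAA'// => -[].
Qed.

(** Test functions with disjoint supports add up to one whose supremum norm is still at most 1. *)
Lemma variation_disjoint A A' : A `&` A' = set0 ->
  variation A + variation A' <= variation (A `|` A').
Proof.
move=> AA'; rewrite -lerBrDr; apply: variation_le => g g1 gA.
rewrite lerBrDr addrC -lerBrDr; apply: variation_le => h h1 hA'.
rewrite lerBrDr addrC -linearD; apply: variation_ge => [|b].
  apply: linfty_norm_le => // b; rewrite -[(g + h) b]/(g b + h b).
  have [Ab|nAb] := pselect (A (pi b)).
    rewrite hA' ?addr0 ?(le_trans (linfty_ub g b))// => A'b.
    by have : (A `&` A') (pi b) by []; rewrite AA'.
  by rewrite gA// add0r (le_trans (linfty_ub h b)).
rewrite -[(g + h) b]/(g b + h b) => nAA'.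
by rewrite gA ?hA' ?addr0// => ?; apply: nAA'; [right|left].
Qed.

Lemma variation_norm A g : (forall b, ~ A (pi b) -> g b = 0) ->
  `|F g| <= `|g| * variation A.
Proof.
have FN (h : linfty R B) : (forall b, ~ A (pi b) -> h b = 0) -> F h <= `|h| * variation A.
  move=> hA; have [->|h0] := eqVneq h 0; first by rewrite linear0 normr0 mul0r.
  have nh0 : 0 < `|h| by rewrite normr_gt0.
  rewrite -ler_pdivrMl// -[_^-1 * _]/(_ *: _) -linearZ; apply: variation_ge => [|b nA].
    by rewrite normrZ ger0_norm ?invr_ge0// mulVf// gt_eqF.
  by rewrite -[LHS]/(_ * h b) hA// mulr0.
move=> gA; rewrite ler_norml FN// andbT lerNl -linearN -normrN FN// => b nA.
by rewrite -[LHS]/(- g b) gA// oppr0.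
Qed.

End Variation.

(** [S] is the support of a regular probability that dominates the normalized variation of [F]. If
    [h] vanishes on [S], each compact set where [|h| >= d] misses the support and hence has
    variation zero; off it [g] is smaller than [d], so [F g] is arbitrarily small. *)
Lemma property_M_functional {R : realType} {K : ptopologicalType} {B : Type}
    (pi : B -> K) (F : {linear linfty R B -> R}) (c : R) :
  hausdorff_space K -> compact [set: K] -> property_M R K ->
  0 <= c -> (forall g, `|F g| <= c * `|g|) ->
  exists2 S : set K, separable_set S &
    forall h : K -> R, continuous h -> (forall k, S k -> h k = 0) ->
    forall g : linfty R B, (forall b, `|g b| <= `|h (pi b)|) -> F g = 0.
Proof.
move=> hausK compK MK c0 F_le.
have F_var := @variation_norm _ _ _ pi F c F_le.
pose m := variation pi F; have m_ge0 A : 0 <= m A.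
  rewrite -(linear0 F); apply: (variation_ge F_le) => //.
  by rewrite normr0 ler01.
(* With zero total variation there is nothing to normalize, but then [F] vanishes and the empty set
   serves as [S]. *)
have [mT0|mT0] := eqVneq (m setT) 0.
  exists set0; first by exists set0; split=> //; exact: sub0set.
  move=> h _ _ g _; apply/eqP; rewrite -normr_le0.
  by have := F_var setT g (fun b nb => False_ind _ (nb I)); rewrite -/m mT0 mulr0.
have mT_gt0 : 0 < m setT by rewrite lt_def mT0 m_ge0.
have [||||P regP PU] :=
    @regular_probability_of_content R K (fun A => m A / m setT) hausK compK.
- by move=> A A' AA'; rewrite ler_pM2r ?invr_gt0// (variation_subset _ F_le).
- by move=> A A'; rewrite -mulrDl ler_pM2r ?invr_gt0// (variationU _ F_le).
- by move=> A A' AA'; rewrite -mulrDl ler_pM2r ?invr_gt0// (variation_disjoint _ F_le).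
- by rewrite divff.
exists (measure_support P); first exact: MK.
move=> h ch hS g gh; apply/eqP; rewrite -normr_le0; apply/ler_addgt0Pr => e e0.
(* Chosen so that [c * (e / (c + 1)) <= e]; the denominator [c + 1] stays positive when [c = 0]. *)
rewrite add0r; have d0 : 0 < e / (c + 1) by rewrite divr_gt0// ltr_wpDl.
pose C := [set k | e / (c + 1) <= `|h k|].
have cC : closed C.
  apply: (@preimage_closed _ _ (fun k => `|h k|) [set x | e / (c + 1) <= x]).
    by move=> x _; apply: continuous_comp; [exact: ch|exact: norm_continuous].
  exact: closed_ge.
have mO (U : set K) : open U -> measurable (U : set (g_sigma_algebraType (@open K))).
  by move=> oU; exact: sub_sigma_algebra.
(* A point of [C] lies outside the support, as [h] is nonzero there, and so has a null open
   neighbourhood. Points off [C] receive the empty set. *)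
have /choice[U UC] k : exists U : set K, [/\ open U, P U = 0%E & C k -> U k].
  have [Ck|nCk] := pselect (C k); last by exists set0; split=> //; exact: open0.
  have /existsNP[U /not_implyP[oU /not_implyP[Uk nP]]] : ~ measure_support P k.
    move=> /hS hk; have : 0 < `|h k| by exact: lt_le_trans d0 Ck.
    by rewrite hk normr0 ltxx.
  exists U; split=> //; apply/eqP; rewrite eq_le measure_ge0 andbT.
  by rewrite leNgt; exact/negP.
have := @subclosed_compact _ C setT cC compK (@subsetT _ C).
rewrite compact_cover => /(_ _ C U) [k Ck|k Ck|D _ CD]; first by have [] := UC k.
  by exists k => //; have [_ _] := UC k; exact.
rewrite /cover bigcup_fset in CD.
pose V := \big[setU/set0]_(i <- finmap.enum_fset D) U i.
have [oV PV] : open V /\ P V = 0%E.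
  apply: (big_ind (fun V : set K => open V /\ P V = 0%E)).
  - by split=> //; exact: open0.
  - move=> A A' [oA PA] [oA' PA']; split; first exact: openU.
    by rewrite measureU0//; exact: mO.
  - by move=> k _; have [] := UC k.
have mC : m C = 0.
  have := PU C V cC oV CD; rewrite PV lee_fin pmulr_lle0 ?invr_gt0// => mC.
  by apply/eqP; rewrite eq_le mC m_ge0.
pose gC := linfty_restrict pi C g.
rewrite -(subrK gC g) linearD (le_trans (ler_normD _ _))//.
have -> : F gC = 0.
  apply/eqP; rewrite -normr_le0; have := F_var C gC; rewrite -/m mC mulr0; apply => b nC.
  by rewrite /gC/=; case: asboolP.
rewrite normr0 addr0 (le_trans (F_le _))// (@le_trans _ _ (c * (e / (c + 1))))//.
  rewrite ler_wpM2l//; apply: linfty_norm_le => [|b]; first exact: ltW.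
  rewrite linfty_distE /gC/=; case: asboolP => [_|nC].
    by rewrite subrr normr0 ltW.
  by rewrite subr0 (le_trans (gh b))// ltW// ltNge; exact/negP.
by rewrite mulrA ler_pdivrMr ?ltr_wpDl// mulrDr mulr1 [c * e]mulrC lerDl ltW.
Qed.

(** * The weak-star topology *)

Lemma ptws_eval_continuous (U : Type) (V : topologicalType) (t : U) :
  continuous (fun f : {ptws U -> V} => f t).
Proof.
move=> f A Af; have /cvg_sup/(_ t) ft : nbhs f --> f by exact: cvg_id.
by apply: ft; exact: (@initial_continuous _ _ (fun f : U -> V => f t) f A Af).
Qed.

Lemma ptws_cvg (U : Type) (V : topologicalType) (F : set_system {ptws U -> V})
    (f : {ptws U -> V}) : Filter F ->
  (forall t, (fun g => g t) @ F --> f t) -> F --> f.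
Proof.
move=> FF Ff; apply/cvg_sup => t A [_ [[W oW <-] Wf] WA].
exact: (@filterS _ F _ _ _ WA (Ff t W (open_nbhs_nbhs (conj oW Wf)))).
Qed.

Lemma dual_of_bounded {R : realType} {X : normedModType R} (f : X -> R) (M : R) :
  linear f -> (forall x, `|f x| <= M * `|x|) ->
  exists d : dual X, forall x, d x = f x.
Proof.
move=> flin fM.
pose L : {linear X -> R} := HB.pack f (GRing.isLinear.Build R X R _ f flin).
have fcont : continuous f.
  apply/(@linear_bounded_continuous _ _ _ L)/linear_boundedP.
  near=> N => x /=; rewrite (le_trans (fM x))//.
  by rewrite ler_wpM2r//; near: N; exact: nbhs_pinfty_ge.
have fD : f \in dual_pred R X by apply/mem_set; split.
by exists (Dual fD).
Unshelve. all: by end_near. Qed.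

Section WeakStar.
Context {R : realType} {X : normedModType R}.

Lemma weak_star_eval_continuous (x : X) :
  continuous (fun f : weak_star X => (f : dual X) x : R).
Proof.
move=> f; apply: (@continuous_comp (weak_star X) {ptws X -> R} R
  (fun f : dual X => (f : {ptws X -> R})) (fun f => f x)).
  exact: initial_continuous.
exact: ptws_eval_continuous.
Qed.

Lemma weak_star_cvg (F : set_system (weak_star X)) (f : weak_star X) : Filter F ->
  (forall x, (fun g : weak_star X => (g : dual X) x : R) @ F --> (f : dual X) x) ->
  F --> f.
Proof.
move=> FF Fx A [_ [[V oV <-] Vf] VA].
have : (fun g : dual X => (g : {ptws X -> R})) @ F --> ((f : dual X) : {ptws X -> R}).
  by apply: ptws_cvg => x; exact: Fx.
by move=> /(_ V (open_nbhs_nbhs (conj oV Vf))) FV; exact: (@filterS _ F FF _ _ VA FV).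
Qed.

Lemma dual_ball_val_continuous : continuous (set_val : dual_ball X -> weak_star X).
Proof. exact: initial_continuous. Qed.

Lemma dual_ball_eval_continuous (x : X) :
  continuous (fun f : dual_ball X => f x : R).
Proof.
move=> f; apply: (@continuous_comp (dual_ball X) (weak_star X) R set_val
  (fun f : dual X => f x)); first exact: dual_ball_val_continuous.
exact: weak_star_eval_continuous.
Qed.

Lemma dual_ball_hausdorff : hausdorff_space (dual_ball X).
Proof.
move=> f g fg; apply/val_inj/val_inj/funext => x.
apply: (@norm_hausdorff R R) => U V Uf Vg.
have Uf' : nbhs f ((fun h : dual_ball X => h x) @^-1` U).
  exact: (@dual_ball_eval_continuous x f U Uf).
have Vg' : nbhs g ((fun h : dual_ball X => h x) @^-1` V).
  exact: (@dual_ball_eval_continuous x g V Vg).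
by have [h [Uh Vh]] := fg _ _ Uf' Vg'; exists ((h : dual_ball X) x).
Qed.

(** Banach-Alaoglu by ultrafilters: each evaluation stays in a compact interval and so converges
    along the ultrafilter; the limits form a linear functional of norm at most 1. *)
Lemma dual_ball_compact : compact [set: dual_ball X].
Proof.
rewrite compact_ultra => F UF _.
pose ev x (f : dual_ball X) : R := f x.
have evx x : exists l : R, `|l| <= `|x| /\ ev x @ F --> l.
  have [|l [+ lF]] := @segment_compact R (- `|x|) `|x| (ev x @ F) _.
    apply: (@filterS _ F _ setT) => [f _|]; last exact: filterT.
    rewrite /= in_itv /= -ler_norml.
    by rewrite (le_trans (dual_norm_le (f : dual_ball X) x))// ler_piMl// dual_ballP.
  rewrite /= in_itv /= -ler_norml => lx; exists l; split=> // U Ul.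
  (* A cluster point of an ultrafilter is a limit: otherwise the filter contains the complement of a
     neighbourhood of [l]. *)
  have [//|FnU] := in_ultra_setVsetC (ev x @^-1` U) UF.
  by have [y [nUy Uy]] := lF (~` U) U FnU Ul.
have [l lP] := choice evx.
have llin : linear l.
  move=> a x y; apply: (@cvg_unique R^o _ (ev (a *: x + y) @ F)) => //.
    by have [_] := lP (a *: x + y).
  have -> : ev (a *: x + y) = (fun f => a * ev x f + ev y f).
    by apply/funext => f; rewrite /ev linearP.
  apply: cvgD; last by have [] := lP y.
  by apply: cvgMr; have [] := lP x.
have [|ld ldE] := @dual_of_bounded R X l 1 llin.
  by move=> x; rewrite mul1r; have [] := lP x.
have lB : (ld : weak_star X) \in [set f : weak_star X | `|f : dual X| <= 1].
  apply/mem_set/sup_norm_le => // x x1.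
  by rewrite ldE; have [lx _] := lP x; rewrite (le_trans lx).
exists (SigSub lB); split=> // A [_ [[V oV <-] Vl] VA].
have : set_val @ F --> (ld : weak_star X).
  by apply: weak_star_cvg => x; rewrite ldE; have [] := lP x.
by move=> /(_ V (open_nbhs_nbhs (conj oV Vl))) FV; exact: (@filterS _ F _ _ _ VA FV).
Qed.

(* [u] is a combination of the evaluations at the points of [s], hence itself an
   evaluation. *)
Lemma kernel_eval (s : seq X) (u : dual X -> R) : linear u ->
  (forall f : dual X, (forall x, x \in s -> f x = 0) -> u f = 0) ->
  exists x : X, forall f, u f = f x.
Proof.
elim: s u => [|y s IHs] u ulin us.
  by exists 0 => f; rewrite linear0 us.
have [[g [gs gy]]|ns] := pselect (exists g : dual X,
    (forall x, x \in s -> g x = 0) /\ g y = 1); last first.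
  apply: IHs => // f fs; apply: us => x; rewrite in_cons => /predU1P[->|]; last exact: fs.
  apply: contrapT => /eqP fy; apply: ns; exists ((f y)^-1 *: f).
  split=> [z zs|]; first by rewrite -[LHS]/(_ * f z) (fs z zs) mulr0.
  by rewrite -[LHS]/(_ * f y) mulVf.
have [|f fs|x ux] := IHs (fun f => u f - u g * f y).
- move=> a f h; rewrite ulin -[dual_val _ y]/(a * f y + h y).
  by rewrite -![_ *: _]/(_ * _) /=; ring.
- suff : u (- f y *: g + f) = 0 by rewrite ulin -[_ *: _]/(_ * _); lra.
  apply: us => x; rewrite in_cons -[dual_val _ x]/(- f y * g x + f x).
  move=> /predU1P[->|xs]; first by rewrite gy mulr1 addNr.
  by rewrite (gs x xs) (fs x xs) mulr0 addr0.
exists (x + u g *: y) => f.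
by rewrite linearD linearZ /= -ux -[_ *: _]/(_ * _); ring.
Qed.

(** The annihilators of finite sets generate a filter that converges weak-star to 0, so [|u| < 1] on
    one of them. This is a subspace, so [u] vanishes on it by scaling, and [kernel_eval] applies. *)
Lemma weak_star_functional (u : weak_star X -> R) : continuous u ->
  linear (u : dual X -> R) -> exists x : X, forall f : dual X, u f = f x.
Proof.
move=> ucont ulin.
pose ker (s : seq X) : set (weak_star X) :=
  [set f | forall x, x \in s -> (f : dual X) x = 0].
pose F := filter_from [set: seq X] ker.
have FF : Filter F.
  apply: filter_from_filter; first by exists [::].
  move=> s t _ _; exists (s ++ t) => // f fst; split=> x xs; apply: fst;
    by rewrite mem_cat xs ?orbT.
have u0 : u (0 : dual X) = 0.
  by have := ulin 1 0 0; rewrite !scale1r addr0; lra.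
have F0 : F --> ((0 : dual X) : weak_star X).
  apply: weak_star_cvg => x; rewrite -[(0 : dual X) x]/(0 : R).
  apply: cvg_near_cst; exists [:: x] => // f; apply; exact: mem_head.
have uF0 : u @ F --> u (0 : dual X).
  by move=> A /(ucont (0 : dual X)); exact: F0.
have /cvgrPdist_lt/(_ _ ltr01)[s _ us] := uF0.
apply: (@kernel_eval s) => // f fs; apply/eqP/negPn/negP => uf0.
have /us : ker s ((u f)^-1 *: f).
  by move=> x xs; rewrite -[LHS]/(_ * f x) (fs x xs) mulr0.
rewrite /= u0 sub0r normrN.
have -> : u ((u f)^-1 *: f) = 1.
  by rewrite -[X in u X]addr0 ulin u0 addr0 -[LHS]/(_ * _) mulVf.
by rewrite normr1 ltxx.
Qed.

End WeakStar.

(** * Separating families with countable supports *)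

Lemma WLD_family {R : realType} {X : completeNormedModType R} : WLD X ->
  exists (G : Type) (x : G -> X), [/\ inhabited G, forall g, `|x g| <= 1,
    forall f : dual X, countable [set g | f (x g) != 0] &
    forall f : dual X, (forall g, f (x g) = 0) -> f = 0].
Proof.
move=> [G [Phi [G0 _ injPhi cPhi wPhi]]].
have /choice[z zP] g : exists z : X, forall f : dual X, Phi f g = f z.
  apply: (@weak_star_functional _ _ (fun f => Phi f g)); last by move=> a f h; rewrite linearP.
  move=> f; apply: (@continuous_comp (weak_star X) {ptws G -> R} R
    (fun f => Phi f : {ptws G -> R}) (fun f => f g)); first exact: wPhi.
  exact: ptws_eval_continuous.
(* Dividing [z g] by [1 + |z g|] brings it into the unit ball without changing which functionals
   vanish at it. *)
have n0 g : 1 + `|z g| != 0 by rewrite gt_eqF// ltr_pwDl.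
exists G, (fun g => (1 + `|z g|)^-1 *: z g); split=> //.
- move=> g; rewrite normrZ ger0_norm ?invr_ge0 ?addr_ge0//.
  by rewrite ler_pdivrMl ?ltr_pwDl// mulr1 lerDr.
- move=> f; apply: sub_countable (cPhi f); apply: subset_card_le => g /=.
  by rewrite linearZ /= zP; apply: contra_neq => ->; exact: mulr0.
- move=> f f0; apply: injPhi; apply/val_inj/funext => g.
  rewrite linear0 [LHS]zP -[RHS]/(0 : R).
  by have /eqP := f0 g; rewrite linearZ mulf_eq0 invr_eq0 (negbTE (n0 g)) => /eqP.
Qed.

Lemma family_WLD {R : realType} {X : completeNormedModType R} (G : Type) (x : G -> X) :
  inhabited G -> (forall g, `|x g| <= 1) ->
  (forall f : dual X, countable [set g | f (x g) != 0]) ->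
  (forall f : dual X, (forall g, f (x g) = 0) -> f = 0) -> WLD X.
Proof.
move=> G0 x1 cx sep.
have fx (f : dual X) g : `|f (x g)| <= `|f|.
  by rewrite (le_trans (dual_norm_le f _))// ler_piMr// sup_norm_ge0.
have fb (f : dual X) : (fun g => f (x g)) \in linfty_pred R G.
  by apply/mem_set/bounded_onP; exists `|f| => g _.
pose phi f := Linfty (fb f).
have philin : linear phi by move=> a f h; exact/val_inj/funext.
have [Phi PhiE] : exists Phi : {linear dual X -> linfty R G},
    forall f g, Phi f g = f (x g).
  by pose Phi : {linear dual X -> linfty R G} := HB.pack phi
    (GRing.isLinear.Build R (dual X) (linfty R G) _ phi philin); exists Phi.
exists G, Phi; split=> //.
- apply/linear_bounded_continuous/linear_boundedP.
  near=> M => f; apply: (@le_trans _ _ (1 * `|f|)).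
    rewrite mul1r; apply: linfty_norm_le => [|g]; first exact: normr_ge0.
    by rewrite PhiE.
  by rewrite ler_wpM2r//; near: M; exact: nbhs_pinfty_ge.
- move=> f h fh; apply/eqP; rewrite -subr_eq0; apply/eqP/sep => g.
  by rewrite -[LHS]/(f (x g) - h (x g)) -!PhiE fh subrr.
- move=> f; apply: sub_countable (cx f); apply: subset_card_le => g /=.
  by rewrite PhiE.
- move=> f; apply: ptws_cvg => [|g A].
    exact: (@fmap_filter _ _ _ (nbhs (f : weak_star X)) _).
  rewrite PhiE => /(@weak_star_eval_continuous _ _ (x g) f) fA.
  by apply: (@filterS _ (nbhs (f : weak_star X)) _ _ _ _ fA) => h; rewrite /= PhiE.
Unshelve. all: by end_near. Qed.

(** The functionals that are nonzero at [x g] form an open set; if it meets [S], it meets the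
    countable dense subset [D]. So the set is a union of countably many countable supports. *)
Lemma separable_countable_support {R : realType} {X : normedModType R} (G : Type)
    (x : G -> X) (S : set (dual_ball X)) :
  (forall f : dual X, countable [set g | f (x g) != 0]) -> separable_set S ->
  countable [set g | exists2 f : dual_ball X, S f & f (x g) != 0].
Proof.
move=> cx [D [cD _ SD]].
apply: (@sub_countable _ _ _ (\bigcup_(f in D) [set g | (f : dual_ball X) (x g) != 0])).
  apply: subset_card_le => g [f /SD Df fg].
  have /Df[h [Dh hg]] : nbhs f [set h : dual_ball X | h (x g) != 0].
    apply: open_nbhs_nbhs; split=> //.
    apply: (@open_comp _ _ (fun h : dual_ball X => h (x g)) [set r : R | r != 0]).
      by move=> h _; exact: dual_ball_eval_continuous.
    exact: open_neq.
  by exists h.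
by apply: bigcup_countable => // f _; exact: cx.
Qed.

(** * Functionals on the injective tensor product *)

Section TensorFunctional.
Context {R : realType} {X Y : completeNormedModType R}.

Lemma elem_tensor_closure (x : X) (y : Y) : elem_tensor x y \in @inj_tensor_pred R X Y.
Proof.
apply/mem_set/subset_closure; exists 1%N, (fun=> x), (fun=> y).
by rewrite big_ord1.
Qed.

Definition tensor (x : X) (y : Y) : inj_tensor X Y := InjTensor (elem_tensor_closure x y).

Lemma tensor_norm (x : X) (y : Y) : `|tensor x y| <= `|x| * `|y|.
Proof.
apply: linfty_norm_le => [|[f g]]; first exact: mulr_ge0.
rewrite /= normrM ler_pM//.
  by rewrite (le_trans (dual_norm_le f x))// ler_piMl// dual_ballP.
by rewrite (le_trans (dual_norm_le g y))// ler_piMl// dual_ballP.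
Qed.

Lemma tensor_linearl y : linear (tensor^~ y).
Proof.
move=> a x x'; apply/val_inj/val_inj/funext => fg.
rewrite -[RHS]/(a * (fg.1 x * fg.2 y) + fg.1 x' * fg.2 y).
rewrite -[LHS]/(fg.1 (a *: x + x') * fg.2 y) dual_linear -[a *: _]/(a * _).
by rewrite mulrDl mulrA.
Qed.

Lemma tensor_linearr x : linear (tensor x).
Proof.
move=> a y y'; apply/val_inj/val_inj/funext => fg.
rewrite -[RHS]/(a * (fg.1 x * fg.2 y) + fg.1 x * fg.2 y').
rewrite -[LHS]/(fg.1 x * fg.2 (a *: y + y')) dual_linear -[a *: _]/(a * _).
by rewrite mulrDr mulrCA.
Qed.

Lemma dual_tensorl (phi : dual (inj_tensor X Y)) y :
  exists d : dual X, forall x, d x = phi (tensor x y).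
Proof.
apply: (@dual_of_bounded _ _ _ (`|phi| * `|y|)) => [a x x'|x].
  by rewrite tensor_linearl linearP.
rewrite (le_trans (dual_norm_le phi _))// -mulrA [`|y| * _]mulrC.
by rewrite ler_wpM2l ?sup_norm_ge0// tensor_norm.
Qed.

Lemma dual_tensorr (phi : dual (inj_tensor X Y)) x :
  exists d : dual Y, forall y, d y = phi (tensor x y).
Proof.
apply: (@dual_of_bounded _ _ _ (`|phi| * `|x|)) => [a y y'|y].
  by rewrite tensor_linearr linearP.
rewrite (le_trans (dual_norm_le phi _))// -mulrA.
by rewrite ler_wpM2l ?sup_norm_ge0// tensor_norm.
Qed.

(** Finite sums of elementary tensors are dense, and [phi] is bounded. *)
Lemma inj_tensor_dual_eq0 (phi : dual (inj_tensor X Y)) :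
  (forall x y, phi (tensor x y) = 0) -> phi = 0.
Proof.
move=> phi0; apply/val_inj/funext => u; rewrite -[RHS]/(0 : R).
apply/eqP; rewrite -normr_le0; apply/ler_addgt0Pr => e e0; rewrite add0r.
have d0 : 0 < e / (`|phi| + 1) by rewrite divr_gt0// ltr_wpDl.
have [_ [[n [x [y ->]]]]] := @inj_tensorP R X Y u _ (nbhsx_ballx (u : linfty R _) _ d0).
rewrite -ball_normE /= => /ltW ux.
pose v := \sum_(i < n) tensor (x i) (y i).
have vE : inj_tensor_val v = \sum_(i < n) elem_tensor (x i) (y i).
  exact: (@big_morph _ _ (@inj_tensor_val R X Y) 0 +%R).
have phiv : phi v = 0 by rewrite linear_sum big1// => i _; exact: phi0.
have -> : phi u = phi (u - v) by rewrite linearB /= phiv subr0.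
rewrite (le_trans (dual_norm_le phi _))//.
rewrite -vE in ux; apply: (le_trans (ler_wpM2l (normr_ge0 phi) ux)).
by rewrite mulrA ler_pdivrMr ?ltr_wpDl// mulrDr mulr1 [_ * e]mulrC lerDl ltW.
Qed.

Lemma inj_tensor_extension (phi : dual (inj_tensor X Y)) :
  exists F : {linear linfty R (dual_ball X * dual_ball Y) -> R},
    (forall u : inj_tensor X Y, F u = phi u) /\ forall g, `|F g| <= `|phi| * `|g|.
Proof.
pose j (u : inj_tensor X Y) := (u : linfty R (dual_ball X * dual_ball Y)).
have jlin : linear j by [].
pose J : {linear inj_tensor X Y -> linfty R (dual_ball X * dual_ball Y)} :=
  HB.pack j (GRing.isLinear.Build R _ _ _ j jlin).
by apply: (@hahn_banach _ _ _ J phi) => // u; exact: dual_norm_le.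
Qed.

Lemma countable_support_l (G : Type) (x : G -> X) (phi : dual (inj_tensor X Y)) :
  (forall f : dual X, countable [set g | f (x g) != 0]) ->
  property_M R (dual_ball X) ->
  countable [set g | exists y, phi (tensor (x g) y) != 0].
Proof.
move=> cx MX; have [F [Fphi Fle]] := inj_tensor_extension phi.
have [S sepS SF] := property_M_functional fst (@dual_ball_hausdorff R X)
  (@dual_ball_compact R X) MX (normr_ge0 phi) Fle.
apply: sub_countable (separable_countable_support cx sepS).
apply: subset_card_le => g [y]; apply: contraPP => /forall2NP nS.
apply/negP; rewrite negbK -Fphi; apply/eqP.
(* On the product of the balls [|f (x g) * f' y| <= |f (|y| *: x g)|], so this function of [f] alone
   dominates the elementary tensor, and it vanishes on [S]. *)
apply: (SF (fun f : dual_ball X => f (`|y| *: x g)) _ _ (elem_tensor (x g) y))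
  => [f|f Sf|[f f']].
- exact: dual_ball_eval_continuous.
- by rewrite linearZ /=; have [//|/negP/negPn/eqP ->] := nS f; exact: mulr0.
- rewrite /= linearZ /= !normrM normr_id mulrC ler_wpM2r//.
  by rewrite (le_trans (dual_norm_le f' y))// ler_piMl// dual_ballP.
Qed.

Lemma countable_support_r (H : Type) (y : H -> Y) (phi : dual (inj_tensor X Y)) :
  (forall f : dual Y, countable [set h | f (y h) != 0]) ->
  property_M R (dual_ball Y) ->
  countable [set h | exists x, phi (tensor x (y h)) != 0].
Proof.
move=> cy MY; have [F [Fphi Fle]] := inj_tensor_extension phi.
have [S sepS SF] := property_M_functional snd (@dual_ball_hausdorff R Y)
  (@dual_ball_compact R Y) MY (normr_ge0 phi) Fle.
apply: sub_countable (separable_countable_support cy sepS).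
apply: subset_card_le => h [x]; apply: contraPP => /forall2NP nS.
apply/negP; rewrite negbK -Fphi; apply/eqP.
apply: (SF (fun f : dual_ball Y => f (`|x| *: y h)) _ _ (elem_tensor x (y h)))
  => [f|f Sf|[f f']].
- exact: dual_ball_eval_continuous.
- by rewrite linearZ /=; have [//|/negP/negPn/eqP ->] := nS f; exact: mulr0.
- rewrite /= linearZ /= !normrM normr_id ler_wpM2r//.
  by rewrite (le_trans (dual_norm_le f x))// ler_piMl// dual_ballP.
Qed.

End TensorFunctional.

Theorem corollary7p4 (R : realType) (X Y : completeNormedModType R)
  (wldX : WLD X) (wldY : WLD Y)
  (hM : property_M R (dual_ball X) \/ property_M R (dual_ball Y)) :
  WLD (inj_tensor X Y).
Proof.
have [G [x [[g0] x1 cx sepX]]] := WLD_family wldX.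
have [H [y [[h0] y1 cy sepY]]] := WLD_family wldY.
apply: (@family_WLD _ _ (G * H) (fun gh => tensor (x gh.1) (y gh.2))).
- by constructor; exact: (g0, h0).
- by move=> gh; rewrite (le_trans (tensor_norm _ _))// mulr_ile1.
- move=> phi; have [MX|MY] := hM.
    (* Property (M) leaves countably many nonzero rows; each has countable support because [phi]
       restricted to a row is a functional on [Y]. *)
    apply: (@sub_countable _ _ _ (\bigcup_(g in [set g | exists y, phi (tensor (x g) y) != 0])
        ((pair g) @` [set h | phi (tensor (x g) (y h)) != 0]))).
      apply: subset_card_le => -[g h] /= gh.
      by exists g; [exists (y h)|exists h].
    apply: bigcup_countable => [|g _]; first exact: countable_support_l.
    apply: sub_countable (card_image_le _ _) _; have [d dE] := dual_tensorr phi (x g).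
    by apply: sub_countable (cy d); apply: subset_card_le => h /=; rewrite dE.
  apply: (@sub_countable _ _ _ (\bigcup_(h in [set h | exists x, phi (tensor x (y h)) != 0])
      ((pair^~ h) @` [set g | phi (tensor (x g) (y h)) != 0]))).
    apply: subset_card_le => -[g h] /= gh.
    by exists h; [exists (x g)|exists g].
  apply: bigcup_countable => [|h _]; first exact: countable_support_r.
  apply: sub_countable (card_image_le _ _) _; have [d dE] := dual_tensorl phi (y h).
  by apply: sub_countable (cx d); apply: subset_card_le => g /=; rewrite dE.
- move=> phi phi0; apply: inj_tensor_dual_eq0 => x' y'.
  (* Separation is used twice: for fixed [h] the family [x] forces [phi] to vanish on all tensors
     with second factor [y h]; then the family [y] does so for the arbitrary first factor [x']. *)
  have [d dE] := dual_tensorr phi x'; rewrite -dE.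
  suff -> : d = 0 by [].
  apply: sepY => h; rewrite dE; have [e eE] := dual_tensorl phi (y h); rewrite -eE.
  suff -> : e = 0 by [].
  by apply: sepX => g; rewrite eE; exact: (phi0 (g, h)).
Qed.
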